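(* There exists a $3$-connected cubic planar graph, of order $420$, that contains no cycle of length $4$, no cycle of length $8$, and no cycle of length $16$.
   Context: Graphs are finite and simple (no loops or multiple edges). A graph is cubic if every vertex has degree $3$; the order of a graph is its number of vertices. A cycle of length $n$ is a subgraph isomorphic to the $n$-cycle (not necessarily induced). A graph is $3$-connected if it has more than $3$ vertices and remains connected after the removal of any set of fewer than $3$ vertices. *)

(* Defs.v *)
From mathcomp Require Import all_boot all_order all_algebra.
From mathcomp Require Import all_classical all_reals all_analysis.

Set Implicit Arguments.
Unset Strict Implicit.
Unset Printing Implicit Defensive.

Import Order.TTheory GRing.Theory Num.Theory.
Import numFieldNormedType.Exports.

Local Open Scope classical_set_scope.
Local Open Scope ring_scope.

Record sgraph := SGraph {
  vertex :> finType;
  edge : rel vertex;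
  edge_sym : symmetric edge;
  edge_irr : irreflexive edge }.

Definition graph_order (G : sgraph) : nat := #|G|.

Definition degree (G : sgraph) (x : G) : nat := #|[set y | edge x y]%SET|.

Definition cubic (G : sgraph) : Prop := forall x : G, degree x = 3%N.

Section RemoveVertices.
Variables (G : sgraph) (S : {set G}).

Definition remove_vertex : finType := {x : G | x \notin S}.

Definition remove_edge : rel remove_vertex :=
  fun x y => edge (val x) (val y).

Lemma remove_edge_sym : symmetric remove_edge.
Proof. by move=> x y; rewrite /remove_edge edge_sym. Qed.

Lemma remove_edge_irr : irreflexive remove_edge.
Proof. by move=> x; rewrite /remove_edge edge_irr. Qed.

Definition remove : sgraph := SGraph remove_edge_sym remove_edge_irr.

End RemoveVertices.

Definition connected_graph (G : sgraph) : Prop :=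
  forall x y : G, connect (@edge G) x y.

Definition k_connected (k : nat) (G : sgraph) : Prop :=
  (k < graph_order G)%N /\
  forall S : {set G}, (#|S| < k)%N -> connected_graph (remove S).

(* The bound on n is needed because [ucycle] also accepts the back-and-forth
   walk along a single edge, which is not a cycle of a simple graph. *)
Definition has_cycle_of_length (G : sgraph) (n : nat) : Prop :=
  (2 < n)%N /\ exists2 c : seq G, ucycle (@edge G) c & size c = n.

(* [A] is a simple (Jordan) arc of the plane with endpoints [P] and [Q]. *)
Definition is_arc (R : realType) (P Q : R * R) (A : set (R * R)) : Prop :=
  exists g : R -> R * R,
    [/\ {within `[0, 1], continuous g},
        {in `[0, 1] &, injective g},
        g 0 = P, g 1 = Q & g @` `[0, 1] = A].

(* [p] places the vertices and [A] draws the edge joining x and y as the point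
   set [A [set x; y]]; the values of [A] at non-edges are irrelevant.  The
   interior of a drawn edge must meet neither a vertex nor another edge. *)
Definition plane_drawing (R : realType) (G : sgraph)
    (p : G -> R * R) (A : {set G} -> set (R * R)) : Prop :=
  let inner (x y : G) := A [set x; y]%SET `\` [set p x; p y] in
  [/\ injective p,
      forall x y : G, edge x y -> is_arc (p x) (p y) (A [set x; y]%SET),
      forall x y z : G, edge x y -> ~ inner x y (p z) &
      forall x y u v : G, edge x y -> edge u v ->
        [set x; y]%SET != [set u; v]%SET ->
        inner x y `&` A [set u; v]%SET = set0].

Definition planar (R : realType) (G : sgraph) : Prop :=
  exists (p : G -> R * R) (A : {set G} -> set (R * R)), plane_drawing p A.

(* Main.v *)
(** Replace every vertex of the prism over a 14-cycle by one and the same planar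
fragment with 15 vertices and three ports, which gives 28 * 15 = 420 vertices.
The fragment has no cycle of length 4 or 8, and it is too small for one of
length 16.  A path crossing it has at least 4 vertices, and at least 6 between
the ports 0 and 1; these two ports are placed so that a cycle around a
quadrilateral of the prism has two crossings of the latter kind, hence at least
20 vertices, whereas any other cycle that leaves a fragment crosses at least 6
of them.  The automorphisms of the prism that act regularly on its vertices
extend to the graph, so a search for short cycles may start in one fragment.

Connectivity: after the removal of two vertices, the fragments that are left
intact are connected to each other because the prism is 3-connected, and every
other vertex escapes to an intact fragment because it still reaches enough
ports of its own fragment.  Planarity is witnessed by a straight-line drawing
with integer coordinates. *)

Require Import Defs.
From Stdlib Require Import ZArith.
From mathcomp Require Import classical_sets reals topology normedtype.
From mathcomp Require Import all_boot all_order all_algebra.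
From mathcomp Require Import ring lra zify ssrZ.

Set Implicit Arguments.
Unset Strict Implicit.
Unset Printing Implicit Defensive.

(* The usual key Z is taken over by the scope of MathComp's [int]. *)
Delimit Scope Z_scope with ZZ.

(** * The inflated prism, on numerical codes *)

Definition base_code := (nat * bool)%type.
(** Plain numbers rather than ordinals, so that adjacency can be evaluated by [vm_compute]; [enc]
    and [dec] link the codes to the finite vertex type. *)
Definition code := (base_code * nat)%type.

Definition next14 (i : nat) := if i == 13 then 0 else i.+1.
Definition prev14 (i : nat) := if i is j.+1 then j else 13.

(** The order matters: entry [j] is the fragment joined to port [j], so port 0 carries the rung and
    ports 1 and 2 the edges along the 14-cycle. *)
Definition base_nbrs (b : base_code) : seq base_code :=
  [:: (b.1, ~~ b.2); (next14 b.1, b.2); (prev14 b.1, b.2)].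

(** The ports are 0, 1 and 2; they have degree two here and get their third edge from the prism. *)
Definition frag_nbrs (x : nat) : seq nat :=
  nth [::]
    [:: [:: 3; 4]; [:: 5; 6]; [:: 7; 8]; [:: 0; 9; 10]; [:: 0; 7; 11];
        [:: 1; 8; 12]; [:: 1; 13; 14]; [:: 2; 4; 11]; [:: 2; 5; 12];
        [:: 3; 10; 11]; [:: 3; 9; 13]; [:: 4; 7; 9]; [:: 5; 8; 14];
        [:: 6; 10; 14]; [:: 6; 12; 13]] x.

(** A rung joins two ports 0; a step along the 14-cycle leaves through port 1 and arrives at port 2,
    or conversely. *)
Definition port_mate (x : nat) : nat := nth 0 [:: 0; 2; 1] x.

Definition nbrs (u : code) : seq code :=
  [seq (u.1, y) | y <- frag_nbrs u.2] ++
  if u.2 < 3 then [:: (nth (0, false) (base_nbrs u.1) u.2, port_mate u.2)]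
  else [::].

Definition base_codes : seq base_code :=
  [seq (i, s) | i <- iota 0 14, s <- [:: false; true]].
Definition codes : seq code := [seq (b, x) | b <- base_codes, x <- iota 0 15].

Definition valid (u : code) : bool := (u.1.1 < 14) && (u.2 < 15).

Lemma mem_base_codes (b : base_code) : (b \in base_codes) = (b.1 < 14).
Proof.
case: b => i s; apply/allpairsP/idP => [[p [+ _ [-> _]]]|lt_i].
  by rewrite mem_iota.
by exists (i, s); split=> //; [rewrite mem_iota | case: s {lt_i}].
Qed.

Lemma mem_codes (u : code) : (u \in codes) = valid u.
Proof.
case: u => b x; apply/allpairsP/idP => [[p [+ + [-> ->]]]|/andP[lt_i lt_x]].
  by rewrite mem_base_codes mem_iota /valid => -> ->.
by exists (b, x); split=> //; [rewrite mem_base_codes | rewrite mem_iota].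
Qed.

Definition simple_cubic_at (u : code) : bool :=
  [&& uniq (nbrs u), size (nbrs u) == 3, u \notin nbrs u, all valid (nbrs u)
    & all (fun v => u \in nbrs v) (nbrs u)].

Lemma simple_cubic_codes : all simple_cubic_at codes.
Proof. by vm_compute. Qed.

Lemma simple_cubic_valid u : valid u -> simple_cubic_at u.
Proof. by rewrite -mem_codes; apply/allP/simple_cubic_codes. Qed.

Lemma valid_nbrs u v : valid u -> v \in nbrs u -> valid v.
Proof.
by move=> /simple_cubic_valid /and5P[_ _ _ /allP nb_u _] /nb_u.
Qed.

Lemma nbrs_sym u v : valid u -> v \in nbrs u -> u \in nbrs v.
Proof.
by move=> /simple_cubic_valid /and5P[_ _ _ _ /allP nb_u] /nb_u.
Qed.

Definition bvertex : finType := ('I_14 * bool)%type.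
Definition gvertex : finType := (bvertex * 'I_15)%type.

Definition benc (b : bvertex) : base_code := (val b.1, b.2).
Definition enc (u : gvertex) : code := (benc u.1, val u.2).
Definition bdec (b : base_code) : bvertex := (inord b.1, b.2).
Definition dec (u : code) : gvertex := (bdec u.1, inord u.2).

Lemma bencK : cancel benc bdec.
Proof. by case=> i s; rewrite /bdec /= inord_val. Qed.
Lemma encK : cancel enc dec.
Proof. by case=> b x; rewrite /dec /= bencK inord_val. Qed.
Lemma valid_enc u : valid (enc u).
Proof. by rewrite /valid /= !ltn_ord. Qed.
Lemma bdecK b : b.1 < 14 -> benc (bdec b) = b.
Proof. by case: b => i s lt_i; rewrite /benc /= inordK. Qed.
Lemma decK u : valid u -> enc (dec u) = u.
Proof. by case: u => b x /andP[? ?]; rewrite /enc /= bdecK // inordK. Qed.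

Definition gedge : rel gvertex := fun u v => enc v \in nbrs (enc u).

Lemma gedge_sym : symmetric gedge.
Proof. by move=> u v; apply/idP/idP; apply/nbrs_sym/valid_enc. Qed.
Lemma gedge_irr : irreflexive gedge.
Proof.
by move=> u; have /and5P[_ _ /negbTE] := simple_cubic_valid (valid_enc u).
Qed.

Definition inflated_prism : sgraph := SGraph gedge_sym gedge_irr.
Local Notation IP := inflated_prism.

Lemma order_inflated_prism : graph_order IP = 420.
Proof. by rewrite /graph_order !card_prod !card_ord card_bool. Qed.

Lemma cubic_inflated_prism : cubic IP.
Proof.
move=> u; have /and5P[Uu /eqP sz_u _ /allP val_u _] :=
  simple_cubic_valid (valid_enc u).
have decKu : {in nbrs (enc u), cancel dec enc} by move=> v /val_u /decK.
rewrite /degree -sz_u -(size_map dec) -(card_uniqP _); last first.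
  by rewrite map_inj_in_uniq //; apply: can_in_inj decKu.
apply: eq_card => v; rewrite inE /= /gedge.
apply/idP/mapP => [uv|[w uw ->]]; last by rewrite decKu.
by exists (enc v); rewrite ?encK.
Qed.

(** * Short cycles *)

(* A conditional rather than [&&], which call-by-value evaluation would not
   short-circuit. *)
Fixpoint closes_up (T : eqType) (nb : T -> seq T) (n : nat) (s u : T)
    (visited : seq T) : bool :=
  if n is m.+1 then
    has (fun w => if w \in visited then false
                  else closes_up nb m s w (w :: visited)) (nb u)
  else s \in nb u.

(** The search tries the next vertex of the path, and uniqueness keeps the later ones out of the
    enlarged list. Hence a failed search refutes every such cycle. *)
Lemma closes_upP (T : eqType) (nb : T -> seq T) (s u : T) (p visited : seq T) :
  path (fun v w => w \in nb v) u p -> s \in nb (last u p) -> uniq p ->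
  ~~ has (mem visited) p -> closes_up nb (size p) s u visited.
Proof.
elim: p u visited => //= w p IHp u visited /andP[uw wp] ps /andP[wNp Up].
rewrite negb_or => /andP[/negbTE wNvis pNvis]; apply/hasP; exists w => //.
rewrite [w \in visited]wNvis IHp //; apply/hasPn => x px; rewrite inE negb_or.
by rewrite (hasPn pNvis x px) andbT; apply: contraNneq wNp => <-.
Qed.

Section CodeAutomorphism.
Variable f : code -> code.
Hypothesis f_inj : injective f.
Hypothesis f_valid : forall u, valid u -> valid (f u).
Hypothesis f_nbrs : forall u, valid u -> nbrs (f u) = map f (nbrs u).

(** Conjugated by [enc] and [dec], [f] becomes an injective, edge-preserving map on vertices, which
    is applied to the whole cycle. *)
Lemma code_aut_ucycle (c : seq IP) u :
  ucycle (@edge IP) c -> u \in c ->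
  exists c' : seq IP, [/\ ucycle (@edge IP) c', size c' = size c
    & dec (f (enc u)) \in c'].
Proof.
move=> /andP[cyc_c Uc] cu; pose g v : IP := dec (f (enc v)).
have encg v : enc (g v) = f (enc v) by rewrite decK // f_valid ?valid_enc.
have g_inj : injective g.
  by move=> v w /(congr1 enc); rewrite !encg => /f_inj/(can_inj encK).
exists (map g c); rewrite size_map; split=> //; last exact: (map_f g cu).
apply/andP; split; last by rewrite map_inj_uniq.
rewrite cycle_map (eq_cycle (e' := edge (s := IP))) // => v w /=.
by rewrite /gedge !encg f_nbrs ?valid_enc // mem_map.
Qed.

End CodeAutomorphism.

Definition rotate_code (u : code) : code := ((next14 u.1.1, u.1.2), u.2).
Definition flip_code (u : code) : code := ((u.1.1, ~~ u.1.2), u.2).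

Lemma next14_inj : injective next14.
Proof.
rewrite /next14 => i j.
by case: eqP => [->|_]; case: eqP => [->|_] //; case.
Qed.

Lemma rotate_inj : injective rotate_code.
Proof. by case=> [[i s] x] [[j t] y] [] /next14_inj-> -> ->. Qed.
Lemma flip_inj : injective flip_code.
Proof. by case=> [[i s] x] [[j t] y] [] -> /negb_inj-> ->. Qed.

(** Neighbour lists can be compared in order because both automorphisms preserve the port labels. *)
Definition commutes_at (f : code -> code) (u : code) : bool :=
  valid (f u) && (nbrs (f u) == map f (nbrs u)).

Lemma rotate_commutes : all (commutes_at rotate_code) codes.
Proof. by vm_compute. Qed.
Lemma flip_commutes : all (commutes_at flip_code) codes.
Proof. by vm_compute. Qed.

Lemma ucycle_from_fibre (c : seq IP) (u : IP) :
  ucycle (@edge IP) c -> u \in c ->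
  exists c' : seq IP, [/\ ucycle (@edge IP) c', size c' = size c
    & dec ((0, false), val u.2) \in c'].
Proof.
have rotP v : valid v -> commutes_at rotate_code v.
  by rewrite -mem_codes; apply/allP/rotate_commutes.
have flipP v : valid v -> commutes_at flip_code v.
  by rewrite -mem_codes; apply/allP/flip_commutes.
have{rotP} [rot_val rot_nb]: (forall v, valid v -> valid (rotate_code v)) /\
    (forall v, valid v -> nbrs (rotate_code v) = map rotate_code (nbrs v)).
  by split=> v /rotP/andP[? /eqP].
have{flipP} [flip_val flip_nb]: (forall v, valid v -> valid (flip_code v)) /\
    (forall v, valid v -> nbrs (flip_code v) = map flip_code (nbrs v)).
  by split=> v /flipP/andP[? /eqP].
(* Rotations only go forward, so [m.+1] of them are applied, the last one wrapping from 13 to 0;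
   index 0 itself makes a full turn. *)
have to0 m (d : seq IP) (v : IP) : m + val v.1.1 = 13 -> ucycle (@edge IP) d ->
    v \in d -> exists d' : seq IP, [/\ ucycle (@edge IP) d', size d' = size d
      & dec ((0, v.1.2), val v.2) \in d'].
  elim: m d v => [|m IHm] d v mv cyc_d dv;
    have [d' [cyc_d' <- d'v]] :=
      code_aut_ucycle rotate_inj rot_val rot_nb cyc_d dv;
    rewrite /rotate_code /next14 /= in d'v.
    by exists d'; move: d'v; rewrite [nat_of_ord _]mv.
  have lt_i : (val v.1.1).+1 < 14.
    by move: mv; move: (val v.1.1) => k <-; rewrite ltnS addSn ltnS leq_addl.
  case: eqP d'v => [i13|_ d'v]; first by rewrite /= i13 in lt_i.
  have [] := IHm d' _ _ cyc_d' d'v; first by rewrite /= inordK // -addSnnS.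
  by move=> e [? <- ve]; exists e; split=> //; rewrite /= inordK in ve.
move=> cyc_c cu; have le13: val u.1.1 <= 13 by rewrite -ltnS ltn_ord.
have [d [cyc_d <-]] := to0 _ _ _ (subnK le13) cyc_c cu.
case: u.1.2 => [du|]; last by exists d.
have [e [cyc_e <- eu]] := code_aut_ucycle flip_inj flip_val flip_nb cyc_d du.
by exists e; split=> //; rewrite decK /valid /= ?ltn_ord in eu.
Qed.

(** A cycle moved into the fragment at [(0, false)] and rotated to start there leaves [n.-1]
    vertices to be found after the first. *)
Lemma no_cycle_of_length n :
  all (fun x => ~~ closes_up nbrs n.-1 ((0, false), x) ((0, false), x)
                  [:: ((0, false), x)]) (iota 0 15) ->
  ~ has_cycle_of_length IP n.
Proof.
move=> no_c [n_gt2 [[|u c] cyc_c sz_c]]; first by rewrite -sz_c in n_gt2.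
have [d [cyc_d sz_d]] := ucycle_from_fibre cyc_c (mem_head u c).
set v := dec _ => dv; have [i p def_d] := rot_to dv.
move: cyc_d; rewrite -(rot_ucycle i) def_d => /andP[cyc_v Uv].
have enc_v : enc v = ((0, false), val u.2) by rewrite decK /valid /= ?ltn_ord.
have sz_p : size p = n.-1 by rewrite -sz_c -sz_d -(size_rot i d) def_d.
have /allP/(_ (val u.2)) := no_c; rewrite mem_iota /= => /(_ (ltn_ord _))/negP.
apply; rewrite -enc_v -sz_p -(size_map enc).
move: cyc_v Uv; rewrite /= rcons_path => /andP[vp pv] /andP[vNp Up].
apply: closes_upP;
  rewrite ?path_map ?last_map ?(map_inj_uniq (can_inj encK)) //.
apply/hasPn => x /mapP[w pw ->]; rewrite /= inE.
by apply: contraNneq vNp => /(can_inj encK) <-.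
Qed.

Lemma no_4_cycle : ~ has_cycle_of_length IP 4.
Proof. by apply: no_cycle_of_length; vm_compute. Qed.
Lemma no_8_cycle : ~ has_cycle_of_length IP 8.
Proof. by apply: no_cycle_of_length; vm_compute. Qed.
Lemma no_16_cycle : ~ has_cycle_of_length IP 16.
Proof. by apply: no_cycle_of_length; vm_compute. Qed.

(** * Connectivity *)

(** Depth-first search with fuel [n]. Forbidden vertices are passed as already visited, and
    therefore also occur in the result. *)
Fixpoint dfs_codes (T : eqType) (nb : T -> seq T) (n : nat) (visited : seq T)
    (x : T) : seq T :=
  if x \in visited then visited
  else if n is m.+1 then
    foldl (dfs_codes nb m) (x :: visited) (nb x)
  else visited.

Definition avoiding_walk (T : eqType) (nb : T -> seq T) (av : pred T)
    (x y : T) : Prop :=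
  exists p, [/\ path (fun u v => v \in nb u) x p, last x p = y
    & all (predC av) (x :: p)].

(** Soundness for every amount of fuel, on which the computed connectivity checks rest. *)
Lemma dfs_codesP (T : eqType) (nb : T -> seq T) n visited x y :
  y \in dfs_codes nb n visited x ->
  y \in visited \/ avoiding_walk nb (mem visited) x y.
Proof.
pose W (vis : seq T) z := y \in vis \/ avoiding_walk nb (mem vis) z y.
have mono n' vis z : {subset vis <= dfs_codes nb n' vis z}.
  elim: n' vis z => [|m IHm] vis z u uv /=; case: ifP => // _.
  have: u \in z :: vis by rewrite inE uv orbT.
  by elim: (nb z) (z :: vis) => //= w s IHs vis' /IHm-/(_ w)/IHs.
suff: y \in dfs_codes nb n visited x -> W visited x by [].
elim: n visited x => [|m IHm] vis x /=; case: ifP => [_|xNvis]; try by left.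
have foldW s vis' : y \in foldl (dfs_codes nb m) vis' s ->
    y \in vis' \/ exists2 z, z \in s & avoiding_walk nb (mem vis') z y.
  elim: s vis' => [|z s IHs] vis' /=; first by left.
  move=> /IHs[/IHm[|]|[w sw [p [wp py /allP pN]]]]; first by left.
    by right; exists z; rewrite ?mem_head.
  (* A walk found later avoids all that was visited by then, in particular the smaller initial
     list. *)
  right; exists w; first by rewrite inE sw orbT.
  by exists p; split=> //; apply/allP=> u /pN; apply: contra => /mono; apply.
case/foldW=> [|[z xz [p [zp py pN]]]].
  rewrite inE /W => /predU1P[->|]; last by left.
  by right; exists [::]; rewrite /= xNvis.
have pNvis : all (predC (mem vis)) (z :: p).
  by apply/allP => u /(allP pN); rewrite /= inE negb_or => /andP[].
right; exists (z :: p); split=> //; first by rewrite /= xz.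
by move: pNvis => /= ->; rewrite xNvis.
Qed.

Arguments dfs_codes : simpl never.

(** Lists standing for all sets of at most two removed elements. *)
Definition small_seqs (T : Type) (s : seq T) : seq (seq T) :=
  [::] :: [seq [:: a] | a <- s] ++ [seq [:: a; b] | a <- s, b <- s].

Lemma mem_small_seqs (T : eqType) (s t : seq T) :
  size t <= 2 -> {subset t <= s} -> t \in small_seqs s.
Proof.
case: t => [|a [|b []]] // _ ts; rewrite !inE ?mem_cat //.
  by rewrite map_f // ts ?mem_head.
apply/orP; right; apply/orP; right; apply/allpairsP; exists (a, b).
by rewrite !ts ?inE ?eqxx ?orbT.
Qed.

(** Reaching all survivors from one of them is enough, as adjacency is symmetric; the fuel 28 is the
    order of the prism. *)
Definition base_survives (av : seq base_code) : bool :=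
  let rest := [seq b <- base_codes | b \notin av] in
  all (mem (dfs_codes base_nbrs 28 av (head (0, false) rest))) rest.

Lemma prism_3_connected : all base_survives (small_seqs base_codes).
Proof. by vm_compute. Qed.

(* With [size av] of the at most two removed vertices inside the fragment, the
   others damage at most [2 - size av] further fragments, so that one of the
   ports reached leads to an intact one. *)
Definition fan_at (av : seq nat) : bool :=
  all (fun x => (x \in av) ||
         let r := dfs_codes frag_nbrs 15 av x in
         3 <= size av + count [pred j | (j \in r) && (j \notin av)] (iota 0 3))
      (iota 0 15).

Lemma fragment_fan : all fan_at (small_seqs (iota 0 15)).
Proof. by vm_compute. Qed.

Definition fragment_connected_from (x : nat) : bool :=
  all (mem (dfs_codes frag_nbrs 15 [::] x)) (iota 0 15).

Lemma fragment_connected : all fragment_connected_from (iota 0 15).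
Proof. by vm_compute. Qed.

Definition base_nbrs_ok (b : base_code) : bool :=
  uniq (b :: base_nbrs b) && all (fun c => c.1 < 14) (base_nbrs b).

Lemma base_nbrs_simple : all base_nbrs_ok base_codes.
Proof. by vm_compute. Qed.

Definition in_frag (b : bvertex) (x : nat) : IP := (b, inord x).
Definition base_nbr (b : bvertex) (j : nat) : bvertex :=
  bdec (nth (0, false) (base_nbrs (benc b)) j).

Lemma benc_nbrs_ok b : base_nbrs_ok (benc b).
Proof.
by apply: (allP base_nbrs_simple); rewrite mem_base_codes /= ltn_ord.
Qed.

Lemma benc_base_nbr b j :
  j < 3 -> benc (base_nbr b j) = nth (0, false) (base_nbrs (benc b)) j.
Proof.
move=> lt_j; have /andP[_ /allP nb_ok] := benc_nbrs_ok b.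
by rewrite bdecK // nb_ok // mem_nth.
Qed.

Lemma base_nbr_neq b j : j < 3 -> base_nbr b j != b.
Proof.
move=> lt_j; have /andP[/andP[bN _] _] := benc_nbrs_ok b.
by apply: contraNneq bN => {1}<-; rewrite benc_base_nbr ?mem_nth.
Qed.

Lemma base_nbr_inj b j k :
  j < 3 -> k < 3 -> base_nbr b j = base_nbr b k -> j = k.
Proof.
move=> lt_j lt_k /(congr1 benc); rewrite !benc_base_nbr // => /eqP.
have /andP[/andP[_ Ub] _] := benc_nbrs_ok b.
by rewrite nth_uniq // => /eqP.
Qed.

Lemma frag_nbrs_lt x y : x < 15 -> y \in frag_nbrs x -> y < 15.
Proof.
move=> lt_x xy; have val_x : valid ((0, false), x) by rewrite /valid lt_x.
have /(valid_nbrs val_x)/andP[] // : ((0, false), y) \in nbrs ((0, false), x).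
by rewrite mem_cat (map_f (pair _)).
Qed.

Lemma mem_head_of_mem (T : eqType) (x0 x : T) s : x \in s -> head x0 s \in s.
Proof. by case: s => //= y s _; rewrite mem_head. Qed.

Lemma pair_inj (b : bvertex) : injective (pair b : 'I_15 -> IP).
Proof. by move=> x y []. Qed.

Lemma edge_in_frag b x y :
  x < 15 -> y \in frag_nbrs x -> edge (in_frag b x) (in_frag b y).
Proof.
move=> lt_x xy; have lt_y := frag_nbrs_lt lt_x xy.
rewrite /= /gedge /enc /= !inordK //.
by rewrite mem_cat (map_f (pair _)).
Qed.

Lemma port_mate_lt j : j < 3 -> port_mate j < 15.
Proof. by case: j => [|[|[]]]. Qed.

Lemma edge_port b j :
  j < 3 -> edge (in_frag b j) (in_frag (base_nbr b j) (port_mate j)).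
Proof.
move=> lt_j; have lt_j15 : j < 15 by apply: leq_trans lt_j _.
rewrite /= /gedge /enc /= benc_base_nbr // !inordK ?port_mate_lt //.
by rewrite mem_cat /= lt_j mem_head orbT.
Qed.

Section Remove.
Variable S : {set IP}.
Hypothesis S_small : #|S| <= 2.

(** A relation on all vertices, so that walks can be built without the subtype underlying
    [remove S]. *)
Let survives : rel IP := [rel u v | [&& edge u v, u \notin S & v \notin S]].

Lemma survives_connect_sym : connect_sym survives.
Proof.
apply: sym_connect_sym => u v; rewrite /survives /= gedge_sym.
by congr (_ && _); apply: andbC.
Qed.

Lemma survives_remove (x y : remove S) :
  connect survives (val x) (val y) -> connect (@edge (remove S)) x y.
Proof.
case/connectP => p; elim: p x => [|w p IHp] x /=.
  by move=> _ /val_inj ->.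
case/andP=> /and3P[xw _ wNS] wp def_y.
by apply: connect_trans (connect1 _) (IHp (Sub w wNS) wp def_y).
Qed.

(** Transfers a walk computed in the bare fragment to its copy at [b], provided [av] covers the
    vertices removed from that copy. *)
Lemma frag_walk b (av : pred nat) x y :
  x < 15 -> (forall z : 'I_15, (b, z) \in S -> av z) ->
  avoiding_walk frag_nbrs av x y ->
  y < 15 /\ connect survives (in_frag b x) (in_frag b y).
Proof.
move=> lt_x S_av [p [+ + +]]; elim: p x lt_x => [|w p IHp] x lt_x.
  by move=> _ <- _; rewrite connect0.
move=> /= /andP[xw wp] py /andP[xN /[dup] /andP[wN _] pN].
have lt_w := frag_nbrs_lt lt_x xw.
have [lt_y wy] := IHp w lt_w wp py pN; split=> //.
apply: connect_trans (connect1 _) wy; rewrite /survives /=.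
apply/and3P; split; first exact: edge_in_frag.
  by apply: contra xN => /S_av; rewrite inordK.
by apply: contra wN => /S_av; rewrite inordK.
Qed.

(** The damaged fragments, of which there are at most two. *)
Let hit : {set bvertex} := [set u.1 | u in S].

Lemma hitPn b x : b \notin hit -> (b, x) \notin S.
Proof. by apply: contra => bxS; apply/imsetP; exists (b, x). Qed.

Lemma unhit_frag b x y : b \notin hit -> x < 15 -> y < 15 ->
  connect survives (in_frag b x) (in_frag b y).
Proof.
move=> bN lt_x lt_y.
have /allP/(_ x) := fragment_connected; rewrite mem_iota => /(_ lt_x).
move=> /allP/(_ y); rewrite mem_iota => /(_ lt_y) /= /dfs_codesP[] //.
by case/(@frag_walk b) => // z; rewrite (negbTE (hitPn _ bN)).
Qed.

(** Each step of the prism walk is lifted by crossing the intact fragment from vertex 0 to the right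
    port, taking the port edge, and going on to vertex 0 of the next fragment. *)
Lemma base_walk (c d : base_code) :
  c.1 < 14 -> avoiding_walk base_nbrs (mem (map benc (enum hit))) c d ->
  connect survives (in_frag (bdec c) 0) (in_frag (bdec d) 0).
Proof.
move=> + [p [+ + +]]; elim: p c => [|w p IHp] c lt_c.
  by move=> _ <- _; rewrite connect0.
move=> /= /andP[cw wp] pd /andP[cN /[dup] /andP[wN _] pN].
have encN (v : base_code) : v.1 < 14 ->
    predC (mem (map benc (enum hit))) v -> bdec v \notin hit.
  move=> lt_v; apply: contra => vhit /=; rewrite -(bdecK lt_v).
  by rewrite map_f // mem_enum.
have lt_w : w.1 < 14.
  have := benc_nbrs_ok (bdec c); rewrite bdecK // => /andP[_ /allP].
  exact.
apply: connect_trans _ (IHp w lt_w wp pd pN).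
(* The position of a neighbour in the list is the port that leads to it. *)
have [j lt_j def_w] : exists2 j, j < 3 & bdec w = base_nbr (bdec c) j.
  exists (index w (base_nbrs c)).
    by rewrite -[3]/(size (base_nbrs c)) index_mem.
  by rewrite /base_nbr bdecK // nth_index.
have lt_m := port_mate_lt lt_j.
have [cNh wNh] := (encN c lt_c cN, encN w lt_w wN).
apply: connect_trans _ (unhit_frag wNh lt_m (ltn0Sn 14)).
have lt_j15 : j < 15 by apply: leq_trans lt_j _.
apply: connect_trans (unhit_frag cNh (ltn0Sn 14) lt_j15) (connect1 _).
rewrite /survives /=; apply/and3P; split; rewrite ?hitPn //.
by rewrite def_w; apply: edge_port.
Qed.

(** Deleting the damaged fragments removes at most two vertices of the prism, so both fragments are
    reached from the root [r] of the computed search. *)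
Lemma unhit_connected b1 b2 x1 x2 : b1 \notin hit -> b2 \notin hit ->
  x1 < 15 -> x2 < 15 ->
  connect survives (in_frag b1 x1) (in_frag b2 x2).
Proof.
move=> b1N b2N lt1 lt2; set av := map benc (enum hit).
have av_small : av \in small_seqs base_codes.
  apply: mem_small_seqs => [|c /mapP[b _ ->]].
    by rewrite size_map -cardE (leq_trans (leq_imset_card _ _)).
  by rewrite mem_base_codes /= ltn_ord.
have restP b : b \notin hit -> benc b \in [seq c <- base_codes | c \notin av].
  move=> bN; rewrite mem_filter mem_base_codes /= ltn_ord andbT.
  by rewrite mem_map ?mem_enum //; apply: can_inj bencK.
have /allP/(_ _ av_small) := prism_3_connected; rewrite /base_survives.
set rest := [seq _ <- _ | _]; set r := head _ _ => /allP reach.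
have r_rest : r \in rest := mem_head_of_mem (0, false) (restP b1 b1N).
have lt_r : r.1 < 14.
  by move: r_rest; rewrite mem_filter mem_base_codes => /andP[].
have from_r b : b \notin hit ->
    connect survives (in_frag (bdec r) 0) (in_frag b 0).
  move=> /restP /[dup]; rewrite {1}mem_filter => /andP[bNav _] /reach.
  case/dfs_codesP => [|/(base_walk lt_r)]; first by rewrite (negbTE bNav).
  by rewrite bencK.
apply: connect_trans _ (unhit_frag b2N (ltn0Sn 14) lt2).
apply: connect_trans (unhit_frag b1N lt1 (ltn0Sn 14)) _.
by apply: connect_trans (from_r b2 b2N); rewrite survives_connect_sym from_r.
Qed.

(** The reachable surviving ports lead to distinct other fragments, and by [fragment_fan] there are
    too many of them for all these fragments to be damaged. *)
Lemma escape (u : IP) : u \notin S ->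
  exists2 v : IP, v.1 \notin hit & connect survives u v.
Proof.
case: u => b x uNS; pose A := [set y : 'I_15 | (b, y) \in S].
have sz_A : #|A| <= 2.
  apply: leq_trans S_small; rewrite -(card_imset _ (@pair_inj b)).
  by apply/subset_leq_card/subsetP => _ /imsetP[y + ->]; rewrite inE.
pose av := [seq val y | y <- enum A].
have av_small : av \in small_seqs (iota 0 15).
  apply: mem_small_seqs => [|_ /mapP[y _ ->]]; first by rewrite size_map -cardE.
  by rewrite mem_iota ltn_ord.
have S_av (z : 'I_15) : (b, z) \in S -> mem av z.
  by move=> bzS; apply: map_f; rewrite mem_enum inE.
have /allP/(_ _ av_small)/allP/(_ (val x)) := fragment_fan.
rewrite mem_iota ltn_ord => /(_ isT) /orP[|].
  case/mapP=> y; rewrite mem_enum inE => byS /val_inj eq_xy.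
  by rewrite eq_xy byS in uNS.
rewrite size_map -cardE; cbv zeta => fan.
pose r := dfs_codes frag_nbrs 15 av x.
pose J := [set j : 'I_3 | (val j \in r) && (val j \notin av)].
have card_J : 3 <= #|A| + #|J|.
  suff <- : count [pred j | (j \in r) && (j \notin av)] (iota 0 3) = #|J|
    by [].
  rewrite -val_enum_ord count_map -size_filter enumT cardE /enum_mem.
  by congr (size _); apply: eq_filter => j; rewrite !inE.
pose E := [set base_nbr b (val j) | j in J].
have card_E : #|E| = #|J|.
  apply: card_imset => j k /base_nbr_inj eq_jk.
  by apply/val_inj/eq_jk; apply: ltn_ord.
(* [A] accounts for the part of [S] in this fragment; every other damaged fragment costs at least
   one further vertex. *)
have hit_b : #|A| + #|hit :\ b| <= #|S|.
  rewrite -(cardsID [set u : IP | u.1 == b] S) leq_add //.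
    rewrite -(card_imset _ (@pair_inj b)).
    apply/subset_leq_card/subsetP => _ /imsetP[y + ->].
    by rewrite !inE eqxx andbT.
  apply: leq_trans (leq_imset_card fst _).
  apply/subset_leq_card/subsetP => c /setD1P[c_b /imsetP[u uS def_c]].
  by rewrite def_c imset_f // !inE uS -def_c c_b.
(* Otherwise [E] would lie in [hit :\ b], giving 3 <= #|A| + #|J| <= #|S| <= 2. *)
have [j Jj bjN] : exists2 j, j \in J & base_nbr b (val j) \notin hit.
  apply/exists_inP; apply: contraT; rewrite negb_exists_in => /forall_inP allE.
  have: E \subset hit :\ b.
    apply/subsetP => _ /imsetP[j Jj ->]; rewrite !inE base_nbr_neq ?ltn_ord //=.
    by move: (allE j Jj); rewrite negbK.
  move/subset_leq_card; rewrite card_E -(leq_add2l #|A|) => leJ.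
  by have := leq_trans card_J (leq_trans leJ (leq_trans hit_b S_small)).
exists (in_frag (base_nbr b (val j)) (port_mate (val j))) => //.
move: Jj; rewrite inE => /andP[xj jN].
have lt_j15 : val j < 15 by apply: leq_trans (ltn_ord j) _.
have jNS : in_frag b (val j) \notin S.
  by apply: contra jN => /S_av; rewrite inordK.
have xj_walk : avoiding_walk frag_nbrs (mem av) (val x) (val j).
  by case/dfs_codesP: xj => //; rewrite (negbTE jN).
have [_] := frag_walk (ltn_ord x) S_av xj_walk.
rewrite {1}/in_frag inord_val => bx_bj; apply: connect_trans bx_bj (connect1 _).
rewrite /survives /=; apply/and3P; split=> //; last exact: hitPn.
exact: edge_port.
Qed.

End Remove.

Lemma inflated_prism_3_connected : k_connected 3 IP.
Proof.
split; first by rewrite order_inflated_prism.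
move=> S ltS x y; apply: survives_remove.
have [[b1 x1] b1N xb1] := escape ltS (valP x).
have [[b2 x2] b2N yb2] := escape ltS (valP y).
apply: connect_trans xb1 _.
rewrite survives_connect_sym; apply: connect_trans yb2 _.
have := unhit_connected ltS b2N b1N (ltn_ord x2) (ltn_ord x1).
by rewrite /in_frag !inord_val.
Qed.

(** * Straight-line drawings *)

Definition zpoint := (Z * Z)%type.
Definition zsegment := (zpoint * zpoint)%type.

(* Conditionals instead of [&&] and [||] keep call-by-value evaluation lazy. *)
Definition below (a b : Z) (e f : zsegment) : bool :=
  let v (P : zpoint) := (a * P.1 + b * P.2)%ZZ in
  if (v e.1 <? v f.1)%ZZ then
    if (v e.1 <? v f.2)%ZZ then
      if (v e.2 <? v f.1)%ZZ then (v e.2 <? v f.2)%ZZ else false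
    else false
  else false.

Definition separated_by (a b : Z) (e f : zsegment) : bool :=
  if below a b e f then true else below a b f e.

(** Twice the signed area of the triangle [P Q S], zero exactly when the points are collinear. *)
Definition zcross (P Q S : zpoint) : Z :=
  ((Q.1 - P.1) * (S.2 - P.2) - (Q.2 - P.2) * (S.1 - P.1))%ZZ.

Definition fork (P Q P' S : zpoint) : bool :=
  if P == P' then zcross P Q S != 0%ZZ else false.

(** The direction is normal to [e], so the test asks that [f] lie strictly on one side of the line
    through [e]. *)
Definition separated_by_normal (e f : zsegment) : bool :=
  separated_by (e.1.2 - e.2.2) (e.2.1 - e.1.1) e f.

(** Certificates tried in turn: a separating vertical or horizontal line, a common endpoint with
    non-parallel directions, the line through one segment missing the other. *)
Definition noncrossing (e f : zsegment) : bool :=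
  if separated_by 1 0 e f then true else
  if separated_by 0 1 e f then true else
  if fork e.1 e.2 f.1 f.2 then true else
  if fork e.1 e.2 f.2 f.1 then true else
  if fork e.2 e.1 f.1 f.2 then true else
  if fork e.2 e.1 f.2 f.1 then true else
  if separated_by_normal e f then true else separated_by_normal f e.

Section Geometry.
Import Order.TTheory GRing.Theory Num.Theory numFieldNormedType.Exports.
Local Open Scope ring_scope.
Local Open Scope classical_set_scope.
Variable R : realType.

Definition zr (z : Z) : R := (int_of_Z z)%:~R.

Lemma zrD a b : zr (a + b)%ZZ = zr a + zr b.
Proof. by rewrite /zr -intrD; congr (_%:~R); apply: (rmorphD int_of_Z). Qed.
Lemma zrM a b : zr (a * b)%ZZ = zr a * zr b.
Proof. by rewrite /zr -intrM; congr (_%:~R); apply: (rmorphM int_of_Z). Qed.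
Lemma zrB a b : zr (a - b)%ZZ = zr a - zr b.
Proof. by rewrite /zr -intrB; congr (_%:~R); apply: (rmorphB int_of_Z). Qed.
Lemma zr_inj : injective zr.
Proof. by move=> a b /intr_inj/(can_inj int_of_ZK). Qed.
Lemma zr_lt a b : (a <? b)%ZZ -> zr a < zr b.
Proof.
move=> lt_ab; rewrite -subr_gt0 -zrB /zr ltr0z.
have [p ->] : exists p, (b - a)%ZZ = Zpos p by exists (Z.to_pos (b - a)); lia.
by rewrite /=; lia.
Qed.

Definition point (P : zpoint) : R * R := (zr P.1, zr P.2).
Lemma point_inj : injective point.
Proof. by case=> a b [c d] [/zr_inj-> /zr_inj->]. Qed.

Definition along (P Q : R * R) (t : R) : R * R :=
  (P.1 + t * (Q.1 - P.1), P.2 + t * (Q.2 - P.2)).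

Definition segment (P Q : R * R) : set (R * R) := along P Q @` `[0, 1].

Lemma segment_sym P Q : segment P Q = segment Q P.
Proof.
suff sub A B : segment A B `<=` segment B A by apply/seteqP; split; apply: sub.
move=> _ [t t01 <-]; move: t01; rewrite /= in_itv /= => /andP[t0 t1].
exists (1 - t); first by rewrite /= in_itv /=; apply/andP; split; lra.
by rewrite /along; congr (_, _); ring.
Qed.

Lemma segment_left P Q : segment P Q P.
Proof.
exists 0; first by rewrite /= in_itv /= lexx ler01.
by rewrite /along !mul0r !addr0; case: P.
Qed.

Lemma continuous_affine (a b : R) : continuous (fun t : R => a + t * b).
Proof.
move=> t; apply: cvgD; first exact: cvg_cst.
by apply: cvgM; [exact: cvg_id | exact: cvg_cst].
Qed.

Lemma continuous_along P Q : continuous (along P Q).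
Proof.
move=> t; pose f a b := a + t * (b - a) : R.
by apply: (@cvg_pair _ _ _ _ (nbhs (f P.1 Q.1)) (nbhs (f P.2 Q.2))) => /=;
  apply: continuous_affine.
Qed.

Lemma segment_arc P Q : P != Q -> is_arc P Q (segment P Q).
Proof.
move=> PQ; exists (along P Q); split => //.
- exact: continuous_subspaceT (@continuous_along P Q).
- move=> s t _ _ [] e1 e2; apply/eqP; rewrite -subr_eq0; apply/eqP.
  have h1 : (s - t) * (Q.1 - P.1) = 0.
    by apply/eqP; rewrite mulrBl subr_eq0; apply/eqP/(addrI _ e1).
  have h2 : (s - t) * (Q.2 - P.2) = 0.
    by apply/eqP; rewrite mulrBl subr_eq0; apply/eqP/(addrI _ e2).
  apply/eqP; apply: contraNT PQ => st0; apply/eqP.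
  move/eqP: h1; rewrite mulf_eq0 (negbTE st0) subr_eq0 => /eqP q1.
  move/eqP: h2; rewrite mulf_eq0 (negbTE st0) subr_eq0 => /eqP q2.
  by case: P Q q1 q2 {e1 e2} => [a b] [c d] /= -> ->.
- by rewrite /along !mul0r !addr0; case: (P).
- by rewrite /along !mul1r !(addrC _ (_ - _)) !subrK; case: (Q).
Qed.

Definition zseg (e : zsegment) : set (R * R) := segment (point e.1) (point e.2).

Lemma convex_gt0 (c d r : R) :
  0 < c -> 0 < d -> 0 <= r -> r <= 1 -> 0 < (1 - r) * c + r * d.
Proof.
move=> c0 d0; rewrite le_eqVlt => /predU1P[<-|r0] r1.
  by rewrite subr0 mul0r mul1r addr0.
by rewrite ltr_wpDl ?mulr_gt0 // mulr_ge0 ?subr_ge0 // ltW.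
Qed.

(** At a common point the linear form with coefficients [a], [b] would be a convex combination of
    its values at the ends of [e] and also of the larger ones at the ends of [f]. *)
Lemma below_disjoint a b e f z : below a b e f -> zseg e z -> zseg f z -> False.
Proof.
rewrite /below; do 3!case: ifP => // /zr_lt; move=> h21 h12 h11 /zr_lt h22.
move: h21 h12 h11 h22; rewrite !zrD !zrM => h21 h12 h11 h22.
move=> [t t01 <-]; move: t01; rewrite /= in_itv /= => /andP[t0 t1].
move=> [s s01 []]; move: s01; rewrite /= in_itv /= => /andP[s0 s1].
move: e f h21 h12 h11 h22 => [[e11 e12] [e21 e22]] [[f11 f12] [f21 f22]] /=.
set A := zr a; set B := zr b.
set x1 := zr e11; set x2 := zr e12; set x3 := zr e21; set x4 := zr e22.
set y1 := zr f11; set y2 := zr f12; set y3 := zr f21; set y4 := zr f22.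
move=> h21 h12 h11 h22 eq1 eq2.
have k1 : A * (y1 + s * (y3 - y1)) + B * (y2 + s * (y4 - y2)) =
  A * (x1 + t * (x3 - x1)) + B * (x2 + t * (x4 - x2)) by rewrite eq1 eq2.
pose u1 := A * x1 + B * x2; pose u2 := A * x3 + B * x4.
pose v1 := A * y1 + B * y2; pose v2 := A * y3 + B * y4.
have k2 : (1 - s) * v1 + s * v2 = (1 - t) * u1 + t * u2.
  by rewrite /u1 /u2 /v1 /v2; lra.
(* The difference is a nested convex combination of the four differences of endpoint values, all
   positive. *)
have m : (1 - s) * v1 + s * v2 - ((1 - t) * u1 + t * u2) =
  (1 - s) * ((1 - t) * (v1 - u1) + t * (v1 - u2)) +
  s * ((1 - t) * (v2 - u1) + t * (v2 - u2)) by ring.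
suff : 0 < (1 - s) * v1 + s * v2 - ((1 - t) * u1 + t * u2).
  by rewrite k2 subrr ltxx.
by rewrite m; do 2?apply: convex_gt0 => //; rewrite subr_gt0.
Qed.

Lemma separated_by_disjoint a b e f z :
  separated_by a b e f -> zseg e z -> zseg f z -> False.
Proof.
rewrite /separated_by; case: ifP => [ef _|_ fe] ez fz.
  exact: below_disjoint ef ez fz.
exact: below_disjoint fe fz ez.
Qed.

(** From t (Q - P) = s (S - P), taking the cross product with S - P gives t * [zcross P Q S] = 0,
    hence t = 0. *)
Lemma fork_meet P Q P' S z : fork P Q P' S ->
  segment (point P) (point Q) z -> segment (point P') (point S) z ->
  z = point P /\ z = point P'.
Proof.
rewrite /fork; case: eqP => // <- nz.
move=> [t t01 <-]; move: t01; rewrite /= in_itv /= => /andP[t0 t1].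
move=> [s s01 []]; move: s01; rewrite /= in_itv /= => /andP[s0 s1].
move=> /addrI e1 /addrI e2.
suff -> : t = 0 by rewrite /along !mul0r !addr0; case: P {e1 e2 nz}.
have : zr (zcross P Q S) != 0.
  by apply: contraNneq nz; rewrite -[0]/(zr 0) => /zr_inj ->.
rewrite /zcross !(zrB, zrM) => c_nz.
apply: (mulIf c_nz); rewrite mul0r mulrBr mulrA -e1 [X in _ - X]mulrA -e2.
by rewrite /=; ring.
Qed.

(** Endpoints of both segments are named because a pair of edges is tested in one order only. *)
Lemma noncrossing_meet e f z : noncrossing e f -> zseg e z -> zseg f z ->
  (z = point e.1 \/ z = point e.2) /\ (z = point f.1 \/ z = point f.2).
Proof.
rewrite /noncrossing => + ez fz.
have ez' : segment (point e.2) (point e.1) z by rewrite segment_sym.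
have fz' : segment (point f.2) (point f.1) z by rewrite segment_sym.
do 2![case: ifP => [/separated_by_disjoint/(_ ez fz)//|_]].
case: ifP => [/fork_meet/(_ ez fz)[? ?]|_]; first by split; left.
case: ifP => [/fork_meet/(_ ez fz')[? ?]|_]; first by split; [left | right].
case: ifP => [/fork_meet/(_ ez' fz)[? ?]|_]; first by split; [right | left].
case: ifP => [/fork_meet/(_ ez' fz')[? ?]|_]; first by split; right.
case: ifP => [/separated_by_disjoint/(_ ez fz)//|_].
by move/separated_by_disjoint/(_ fz ez).
Qed.

End Geometry.

(** * Planarity *)

(** Corner [j] holds port [j]: port 0 faces the other ring, ports 1 and 2 the next and the previous
    fragment. *)
Definition outer_triangles : seq (zpoint * zpoint * zpoint) :=
  ([:: ((23, 5), (27, 9), (28, 4));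
       ((19, 15), (20, 20), (24, 15));
       ((10, 21), (10, 26), (15, 24));
       ((0, 24), (-3, 28), (3, 28));
       ((-10, 21), (-15, 24), (-10, 26));
       ((-19, 15), (-24, 15), (-20, 20));
       ((-23, 5), (-28, 4), (-27, 9))])%ZZ.

Definition inner_triangles : seq (zpoint * zpoint * zpoint) :=
  ([:: ((18, 4), (13, 4), (14, 2));
       ((14, 11), (10, 10), (12, 8));
       ((8, 16), (5, 13), (7, 12));
       ((0, 18), (-1, 14), (1, 14));
       ((-8, 16), (-7, 12), (-5, 13));
       ((-14, 11), (-12, 8), (-10, 10));
       ((-18, 4), (-14, 2), (-13, 4))])%ZZ.

(* Barycentric coordinates, times 17, of a Tutte embedding of the fragment in
   the triangle spanned by its three ports. *)
Definition barycentric : seq (Z * Z * Z) :=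
  ([:: (17, 0, 0); (0, 17, 0); (0, 0, 17); (12, 3, 2); (11, 1, 5);
       (1, 11, 5); (3, 12, 2); (7, 1, 9); (1, 7, 9); (10, 3, 4); (9, 5, 3);
       (9, 2, 6); (2, 9, 6); (5, 9, 3); (3, 10, 4)])%ZZ.

(* Half of the triangles suffice: the ring is drawn centrally symmetric. *)
Definition position (u : code) : zpoint :=
  let: ((i, s), x) := u in
  let: (a, b, c) := nth (0, 0, 0)%ZZ barycentric x in
  let: (P, Q, W) :=
    nth ((0, 0), (0, 0), (0, 0))%ZZ
      (if s then inner_triangles else outer_triangles)
      (if i < 7 then i else i - 7) in
  let e := if i < 7 then 1%ZZ else (-1)%ZZ in
  (e * (a * P.1 + b * Q.1 + c * W.1), e * (a * P.2 + b * Q.2 + c * W.2))%ZZ.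

(** A mixed-radix numbering that serves to list each edge in one orientation. *)
Definition code_index (u : code) : nat := (u.1.1 + u.1.1 + u.1.2) * 15 + u.2.

Definition edge_codes : seq (code * code) :=
  [seq (u, v) | u <- codes,
     v <- [seq v <- nbrs u | code_index u < code_index v]].

Definition edge_segment (e : code * code) : zsegment :=
  (position e.1, position e.2).

Lemma edges_noncrossing : pairwise noncrossing (map edge_segment edge_codes).
Proof. by vm_compute. Qed.

Lemma position_uniq : uniq (map position codes).
Proof. by vm_compute. Qed.

Lemma pairwise_total (T : eqType) (r : rel T) (s : seq T) (x y : T) :
  pairwise r s -> x \in s -> y \in s -> x != y -> r x y || r y x.
Proof.
elim: s => //= a s IHs /andP[/allP ar rs].
rewrite !inE => /predU1P[->|sx] /predU1P[->|sy]; rewrite ?eqxx //.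
- by move=> _; rewrite ar.
- by move=> _; rewrite ar ?orbT.
- exact: IHs.
Qed.

Lemma code_index_inj u v : valid u -> valid v ->
  code_index u = code_index v -> u = v.
Proof.
case: u v => [[i s] x] [[j t] y] /andP[/= _ lt_x] /andP[/= _ lt_y].
rewrite /code_index /= => eq_uv; have {}eq_uv : i = j /\ s = t /\ x = y.
  by case: s t eq_uv => [] [] /=; lia.
by case: eq_uv => -> [-> ->].
Qed.

Lemma mem_edge_codes (u v : IP) : edge u v ->
  (enc u, enc v) \in edge_codes \/ (enc v, enc u) \in edge_codes.
Proof.
move=> uv; have vu : edge v u by rewrite edge_sym.
have mem_E (x y : IP) : edge x y -> code_index (enc x) < code_index (enc y) ->
    (enc x, enc y) \in edge_codes.
  move=> xy lt_xy; apply/allpairsPdep; exists (enc x), (enc y).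
  by rewrite mem_codes valid_enc mem_filter lt_xy.
case: (ltngtP (code_index (enc u)) (code_index (enc v))) => [||eq_uv].
- by left; apply: mem_E.
- by right; apply: mem_E.
have := code_index_inj (valid_enc u) (valid_enc v) eq_uv.
by move/(can_inj encK) => def_u; rewrite def_u edge_irr in uv.
Qed.

Lemma uniq_map_inj (T U : eqType) (f : T -> U) (s : seq T) :
  uniq (map f s) -> {in s &, injective f}.
Proof.
elim: s => //= a s IHs /andP[aN Us] x y; rewrite !inE.
case/predU1P=> [->|sx] /predU1P[->|sy] // eq_f; last exact: IHs eq_f.
  by rewrite eq_f map_f in aN.
by rewrite -eq_f map_f in aN.
Qed.

Lemma position_inj (u v : IP) : position (enc u) = position (enc v) -> u = v.
Proof.
move/(uniq_map_inj position_uniq) => eq_uv; apply/(can_inj encK)/eq_uv;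
  by rewrite mem_codes valid_enc.
Qed.

Section Drawing.
Variable R : realType.
Local Open Scope classical_set_scope.

Definition placement (u : IP) : R * R := point R (position (enc u)).

Definition drawing (e : {set IP}) : set (R * R) :=
  [set z | exists x y : IP, [/\ e = [set x; y]%SET, edge x y
    & segment (placement x) (placement y) z]].

Lemma placement_inj : injective placement.
Proof. by move=> u v /point_inj/position_inj. Qed.

Lemma eq_set2 (T : finType) (x y u v : T) : [set x; y]%SET = [set u; v]%SET ->
  (x = u /\ y = v) \/ (x = v /\ y = u).
Proof.
move=> eq2; have : x \in [set u; v]%SET by rewrite -eq2 set21.
have : y \in [set u; v]%SET by rewrite -eq2 set22.
have : u \in [set x; y]%SET by rewrite eq2 set21.
have : v \in [set x; y]%SET by rewrite eq2 set22.
rewrite !inE.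
by do 4![case/orP=> /eqP ?]; subst; auto.
Qed.

Lemma drawing_edge (x y : IP) : edge x y ->
  drawing [set x; y]%SET = segment (placement x) (placement y).
Proof.
move=> xy; apply/seteqP; split=> z; last by exists x, y.
by case=> u [v [/eq_set2[[-> ->]|[-> ->]] _]] //; rewrite segment_sym.
Qed.

(** Both edges are replaced by their listed orientations; these are different entries of
    [edge_codes], so the computed check applies to them in one of the two orders. *)
Lemma drawn_edges_meet (x y u v : IP) z :
  edge x y -> edge u v -> [set x; y]%SET != [set u; v]%SET ->
  segment (placement x) (placement y) z ->
  segment (placement u) (placement v) z ->
  z = placement x \/ z = placement y.
Proof.
have oriented (a b : IP) : edge a b -> segment (placement a) (placement b) z ->
    exists e : code * code, [/\ e \in edge_codes, zseg (edge_segment e) z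
      & e = (enc a, enc b) \/ e = (enc b, enc a)].
  move=> /mem_edge_codes[ab|ba] abz.
    by exists (enc a, enc b); split=> //; left.
  by exists (enc b, enc a); split=> //; [rewrite /zseg segment_sym | right].
move=> xy uv ne /(oriented _ _ xy)[e [Ee ez def_e]].
move=> /(oriented _ _ uv)[f [Ef fz def_f]].
have ne_ef : e != f.
  apply: contraNneq ne => eq_ef; move: def_e def_f; rewrite eq_ef.
  case=> -> [] /eqP; rewrite xpair_eqE !(inj_eq (can_inj encK));
    by case/andP=> /eqP-> /eqP->; rewrite // setUC.
have := edges_noncrossing; rewrite pairwise_map => /pairwise_total noncr.
have [ze _] : (z = point R (edge_segment e).1 \/ z = point R (edge_segment e).2)
    /\ True.
  by case/orP: (noncr _ _ Ee Ef ne_ef) => /= /noncrossing_meet meet; split=> //;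
    [have [] := meet _ z ez fz | have [] := meet _ z fz ez].
by case: def_e ze => -> [] ->; [left | right | right | left].
Qed.

(** Makes every vertex an end of a drawn edge, which reduces a vertex lying on an edge to two edges
    meeting. *)
Lemma has_neighbour (z : IP) : exists w : IP, edge z w.
Proof.
have : 0 < degree z by rewrite cubic_inflated_prism.
by case/card_gt0P => w; rewrite inE; exists w.
Qed.

Lemma planar_inflated_prism : planar R IP.
Proof.
exists placement, drawing; split.
- exact: placement_inj.
- move=> x y xy; rewrite drawing_edge //; apply: segment_arc.
  by apply: contraTneq xy => /placement_inj ->; rewrite edge_irr.
- move=> x y z xy [+ z_xy]; rewrite drawing_edge // => xyz.
  (* The edge from [z] to [w] differs from that between [x] and [y], since [z] is neither of these,
     and it contains the point of [z]. *)
  have [w zw] := has_neighbour z.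
  apply: (z_xy); apply: (drawn_edges_meet xy zw) xyz (segment_left _ _).
  apply/eqP=> /setP/(_ z); rewrite !inE eqxx.
  by case/orP=> /eqP zE; apply: z_xy; rewrite zE; first [by left | by right].
move=> x y u v xy uv ne; rewrite !drawing_edge //.
apply/seteqP; split=> // z [[xyz z_xy] uvz].
exact/z_xy/(drawn_edges_meet xy uv ne xyz uvz).
Qed.

End Drawing.

Theorem mainTheorem1 (R : realType) :
  exists G : sgraph,
    k_connected 3 G /\ cubic G /\ planar R G /\ graph_order G = 420 /\
    ~ has_cycle_of_length G 4 /\
    ~ has_cycle_of_length G 8 /\
    ~ has_cycle_of_length G 16.
Proof.
exists IP; split; first exact: inflated_prism_3_connected.
split; first exact: cubic_inflated_prism.
split; first exact: planar_inflated_prism.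
split; first exact: order_inflated_prism.
by split; [exact: no_4_cycle | split; [exact: no_8_cycle | exact: no_16_cycle]].
Qed.
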